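(* Let $X$ be a locally finite metric space. Then the following conditions are equivalent: (i) the space $X$ is paradoxical; (ii) there exists a mapping $\phi\colon X\to X$ in $\mathcal{B}(X)$ such that $|\phi^{-1}(x)|=2$ for all $x\in X$; (iii) there exists a mapping $\phi\colon X\to X$ in $\mathcal{B}(X)$ such that $|\phi^{-1}(x)|\ge 2$ for all $x\in X$ (that is, $X$ satisfies the Gromov condition); (iv) the space $X$ satisfies the doubling condition; (v) there exists a real number $K>0$ for which the bipartite graph $B_K(X,X)$ has a perfect $(2,1)$-matching; (vi) the pseudogroup $\mathcal{W}(X)$ does not satisfy the Følner condition.
   Context: A metric space $(X,d)$ is locally finite if its subsets of finite diameter are finite. $\mathcal{B}(X)$ denotes the collection of all maps $\phi\colon S\to T$ (not necessarily bijective) between subsets $S,T$ of $X$ with $\sup_{x\in S}d(\phi(x),x)<\infty$. $\mathcal{W}(X)$ denotes the set (a pseudogroup of transformations of $X$) of all bijections $\gamma\colon S\to T$ between subsets $S,T$ of $X$ with $\sup_{x\in S}d(\gamma(x),x)<\infty$; for such $\gamma$ write $\alpha(\gamma)=S$, $\omega(\gamma)=T$. $X$ is paradoxical if there exist a partition $X=X_1\sqcup X_2$ and $\gamma_1,\gamma_2\in\mathcal{W}(X)$ with $\alpha(\gamma_j)=X_j$ and $\omega(\gamma_j)=X$ for $j=1,2$. For $A\subset X$ and $k>0$, $\mathcal{N}_k(A)=\{x\in X: d(x,A)\le k\}$. $X$ satisfies the doubling condition if there is a constant $K>0$ such that $|\mathcal{N}_K(F)|\ge 2|F|$ for every non-empty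 finite subset $F$ of $X$. For $S,T\subset X$ and real $K\ge 0$, $B_K(S,T)$ is the bipartite graph whose two vertex classes are (disjoint copies of) $S$ and $T$, with an edge connecting $x\in S$ and $y\in T$ whenever $d(x,y)\le K$. For a bipartite graph with vertex classes $Y,Z$ and edge set $E$, a perfect $(k,l)$-matching is a subset $M\subset E$ such that every $y\in Y$ is incident to exactly $k$ edges of $M$ and every $z\in Z$ is incident to exactly $l$ edges of $M$. For $\mathcal{R}\subset\mathcal{W}(X)$ and $A\subset X$, $\partial_{\mathcal{R}}A=\{x\in X\setminus A:\text{there exists }\rho\in\mathcal{R}\cup\mathcal{R}^{-1}\text{ with }x\in\alpha(\rho)\text{ and }\rho(x)\in A\}$. $\mathcal{W}(X)$ satisfies the Følner condition if for every finite $\mathcal{R}\subset\mathcal{W}(X)$ and every real $\epsilon>0$ there exists a finite non-empty $F\subset X$ with $|\partial_{\mathcal{R}}F|<\epsilon|F|$. *)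

(* Defs.v *)
From mathcomp Require Import all_boot all_order all_algebra.
From mathcomp Require Import all_classical all_reals all_analysis.

Set Implicit Arguments.
Unset Strict Implicit.
Unset Printing Implicit Defensive.

Import Order.TTheory GRing.Theory Num.Theory.

Local Open Scope classical_set_scope.
Local Open Scope card_scope.
Local Open Scope ring_scope.

Section MetricNotions.
Context {R : realType} {X : metricType R}.
Implicit Types (A F S T : set X) (k K : R).

(* -oo when A is empty, so that the empty set has finite diameter *)
Definition diameter A : \bar R :=
  ereal_sup [set (mdist x y)%:E | x in A & y in A].

(* +oo when A is empty *)
Definition dist_set (x : X) A : \bar R :=
  ereal_inf [set (mdist x a)%:E | a in A].

Definition neighborhood k A : set X := [set x | (dist_set x A <= k%:E)%E].

(* -oo when S is empty, so that the empty map has finite displacement *)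
Definition displacement S (phi : X -> X) : \bar R :=
  ereal_sup [set (mdist (phi x) x)%:E | x in S].

(* phi, restricted to S, is a map S -> T at bounded distance from the
   inclusion; its values outside S are irrelevant. *)
Definition bounded_map S T (phi : X -> X) : Prop :=
  set_fun S T phi /\ (displacement S phi < +oo)%E.

End MetricNotions.

Definition locally_finite (R : realType) (X : metricType R) : Prop :=
  forall A : set X, (diameter A < +oo)%E -> finite_set A.

(* The pseudogroup W(X).  A bijection alpha -> omega is encoded by its
   extension to X by the identity outside alpha, so that distinct records
   (up to proof irrelevance) are distinct partial bijections. *)
Record pseudogroup (R : realType) (X : metricType R) := Pseudogroup {
  alpha : set X;
  omega : set X;
  pfun :> X -> X;
  pfun_bounded : bounded_map alpha omega pfun;
  pfun_bij : set_bij alpha omega pfun;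
  pfun_out : forall x, ~ alpha x -> pfun x = x
}.

Section Inverse.
Context {R : realType} {X : metricType R}.
Variable g : pseudogroup X.

Definition inv_fun : X -> X := 'pinv_id (alpha g) g.

Lemma inv_funK : {in alpha g, cancel g inv_fun}.
Proof. by apply: pinvKV; have [] := pfun_bij g. Qed.

Lemma inv_fun_bij : set_bij (omega g) (alpha g) inv_fun.
Proof.
have [gf ginj gsurj] := pfun_bij g.
have gE : g @` alpha g = omega g.
  by apply/seteqP; split => // _ [x gx <-]; exact: gf.
by rewrite -gE; exact: injpinv_bij.
Qed.

Lemma inv_fun_bounded : bounded_map (omega g) (alpha g) inv_fun.
Proof.
have [iffun _ _] := inv_fun_bij; split=> //.
have [gf ginj gsurj] := pfun_bij g; have [_] := pfun_bounded g.
apply: le_lt_trans; apply: ereal_sup_le => _ [y gy <-].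
have [x gx <-] := gsurj _ gy; exists x => //.
by rewrite inv_funK ?inE// metric_sym.
Qed.

Lemma inv_fun_out x : ~ omega g x -> inv_fun x = x.
Proof.
have [gf _ _] := pfun_bij g => gx.
rewrite /inv_fun /pinv_ splitV.
pose s : set_surj (alpha g) (g @` alpha g) g := fun=> id.
rewrite -[X in odflt _ X]/('oinv_s x) oinv_surj.
by case: pselect => // -[y gy yx]; case: gx; rewrite -yx; exact: gf.
Qed.

Definition pinverse : pseudogroup X :=
  Pseudogroup inv_fun_bounded inv_fun_bij inv_fun_out.

End Inverse.

Section Conditions.
Context {R : realType}.
Variable X : metricType R.

Definition paradoxical : Prop :=
  exists (X1 X2 : set X) (g1 g2 : pseudogroup X),
    [/\ X1 `&` X2 = set0, X1 `|` X2 = setT,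
        alpha g1 = X1 /\ omega g1 = setT &
        alpha g2 = X2 /\ omega g2 = setT].

(* [counting A] is the number of elements of A, and +oo if A is infinite. *)
Definition doubling : Prop :=
  exists2 K : R, 0 < K &
    forall F : set X, finite_set F -> F !=set0 ->
      (2%:E * counting F <= counting (neighborhood K F) :> \bar R)%E.

Definition boundary (Q : set (pseudogroup X)) (A : set X) : set X :=
  [set x | ~ A x /\ exists2 rho : pseudogroup X,
    (Q `|` @pinverse R X @` Q) rho & alpha rho x /\ A (rho x)].

Definition Folner : Prop :=
  forall Q : set (pseudogroup X), finite_set Q ->
  forall eps : R, 0 < eps ->
  exists F : set X, [/\ finite_set F, F !=set0 &
    (counting (boundary Q F) < eps%:E * counting F)%E].

End Conditions.

(* The two vertex classes are subsets of the two sides Y and Z, and edges are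
   ordered pairs: the classes are kept disjoint even when Y = Z. *)
Record bipartite_graph (Y Z : Type) := BipartiteGraph {
  lvertices : set Y;
  rvertices : set Z;
  edges : set (Y * Z);
  edges_sub : edges `<=` lvertices `*` rvertices
}.

Definition perfect_matching (Y Z : Type) (k l : nat)
    (G : bipartite_graph Y Z) (M : set (Y * Z)) : Prop :=
  [/\ M `<=` edges G,
      forall y, lvertices G y -> [set e | M e /\ e.1 = y] #= `I_k &
      forall z, rvertices G z -> [set e | M e /\ e.2 = z] #= `I_l].

Section DistanceGraph.
Context {R : realType} {X : metricType R}.
Variables (K : R) (S T : set X).

Definition dist_edges : set (X * X) :=
  [set e | [/\ S e.1, T e.2 & mdist e.1 e.2 <= K]].

Lemma dist_edges_sub : dist_edges `<=` S `*` T.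
Proof. by move=> e []. Qed.

Definition dist_graph : bipartite_graph X X := BipartiteGraph dist_edges_sub.

End DistanceGraph.

(* Main.v *)
(* Every condition is compared with the existence of an injection
   f : X * bool -> X at bounded distance from the first projection.  Doubling is
   Hall's condition for the graph joining (x, b) to the K-neighbours of x, and
   this graph is locally finite, so Hall's theorem yields f; merging f with the
   injection x |-> (x, true) by Cantor-Bernstein makes it bijective, and a
   bounded bijection X * bool -> X is at once a paradoxical decomposition and a
   perfect (2,1)-matching.  If the Folner condition fails for Q and eps, the
   neighborhoods of radius bounding Q expand finite sets by the factor 1 + eps,
   and iterating this expansion gives doubling. *)
Require Import Defs.
From mathcomp Require Import all_boot all_order all_algebra.
From mathcomp Require Import finmap.
From mathcomp Require Import all_classical all_reals all_analysis.
From mathcomp Require Import lra.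

Set Implicit Arguments.
Unset Strict Implicit.
Unset Printing Implicit Defensive.

Import Order.TTheory GRing.Theory Num.Theory.

Local Open Scope classical_set_scope.
Local Open Scope card_scope.
Local Open Scope ring_scope.

(** * Hall's marriage theorem for infinite families of finite sets *)

Lemma chain_bigcup_seq (U : eqType) (F : set (set U)) (E0 : set U) (s : seq U) :
  F E0 -> total_on F subset ->
  exists2 E, F E & forall u, u \in s -> (\bigcup_(D in F) D) u -> E u.
Proof.
move=> FE0 totF; elim: s => [|v s [E FE sE]]; first by exists E0.
have [[D FD Dv]|nFv] := pselect ((\bigcup_(D in F) D) v); last first.
  exists E => // u; rewrite inE => /orP[/eqP->//|]; exact: sE.
have [ED|DE] := totF _ _ FE FD.
  exists D => // u; rewrite inE => /orP[/eqP->//|us Fu].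
  exact/ED/sE.
exists E => // u; rewrite inE => /orP[/eqP-> _|us Fu]; [exact: DE|exact: sE].
Qed.

Section Hall.
Variables I T : choiceType.

Definition hall_condition (B : I -> {fset T}) : Prop :=
  forall S : {fset I}, (#|` S| <= #|` \bigcup_(i <- S) B i|)%fset%N.

(** Submodularity: the neighbourhoods of the union and of the intersection of [S] and [S'] fit into
    the union and the intersection of the two sets on the right. As [D] and [D'] together cover
    [B i], adding [i] to the union costs no new neighbours, whence the extra one. *)
Lemma hall_condition_sum (B : I -> {fset T}) (S S' : {fset I}) (i : I)
    (D D' : {fset T}) :
  hall_condition B -> i \notin S -> i \notin S' ->
  (B i `<=` D `|` D')%fset ->
  ((#|` S| + #|` S'|).+1 <=
    #|` (\bigcup_(j <- S) B j) `|` D| + #|` (\bigcup_(j <- S') B j) `|` D'|)%fset%N.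
Proof.
move=> hallB iS iS' BD; rewrite -(cardfsUI S) -[leqRHS]cardfsUI -addSn.
apply: leq_add.
  apply: leq_trans (_ : #|` (i |` (S `|` S'))%fset| <= _)%N.
    by rewrite cardfsU1 !inE (negPf iS) (negPf iS').
  apply: leq_trans (hallB _) _; apply: fsubset_leq_card.
  apply/bigfcupsP => j; rewrite !inE => /or3P[/eqP->|jS|jS'] _.
  - apply: fsubset_trans BD _; apply/fsubsetP => x; rewrite !inE.
    by case/orP=> ->; rewrite !orbT.
  - apply: fsubset_trans (bigfcup_sup B jS isT) _; apply/fsubsetP => x.
    by rewrite !inE => ->.
  - apply: fsubset_trans (bigfcup_sup B jS' isT) _; apply/fsubsetP => x.
    by rewrite !inE => ->; rewrite !orbT.
apply: leq_trans (hallB _) _; apply: fsubset_leq_card.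
apply/bigfcupsP => j; rewrite !inE => /andP[jS jS'] _.
apply/fsubsetP => x xj; rewrite !inE.
by rewrite (fsubsetP (bigfcup_sup B jS isT) _ xj)
           (fsubsetP (bigfcup_sup B jS' isT) _ xj).
Qed.

Variable A : I -> {fset T}.

(** [E] collects the deleted edges, so that deleting more means a larger [E] and Zorn's lemma
    applies to unions of chains. *)
Definition residual (E : set (I * T)) (i : I) : {fset T} :=
  [fset x in A i | `[< ~ E (i, x) >]]%fset.

Lemma in_residual E i x : (x \in residual E i) = (x \in A i) && `[< ~ E (i, x) >].
Proof. by rewrite !inE. Qed.

(** Hall's condition at [S] involves only the finitely many pairs [(i, x)] with [i] in [S] and [x]
    in [A i], and a single member of the chain contains all those that the union contains. The empty
    chain deletes nothing and falls back on [A]. *)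
Lemma residual_hall_chain (F : set (set (I * T))) :
  hall_condition A -> F `<=` [set E | hall_condition (residual E)] ->
  total_on F subset -> hall_condition (residual (\bigcup_(E in F) E)).
Proof.
move=> hallA hallF totF S.
have [F0|/set0P[E0 FE0]] := eqVneq F set0.
  rewrite F0 bigcup_set0; apply: leq_trans (hallA S) _.
  apply: fsubset_leq_card; apply/bigfcupsP => i iS _.
  apply: fsubset_trans (bigfcup_sup _ iS isT).
  by apply/fsubsetP => x xi; rewrite in_residual xi; apply/asboolP.
have [E FE hE] := chain_bigcup_seq [seq (i, x) | i <- S, x <- A i] FE0 totF.
apply: leq_trans (hallF _ FE S) _; apply: fsubset_leq_card.
apply/bigfcupsP => i iS _; apply: fsubset_trans (bigfcup_sup _ iS isT).
apply/fsubsetP => x; rewrite !in_residual => /andP[xi /asboolP nE].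
rewrite xi; apply/asboolP => FU; apply: nE; apply: hE FU.
exact: allpairs_f_dep.
Qed.

(** A set violating Hall's condition after the deletion must contain [i], the only vertex that loses
    a neighbour; taking [i] out of it leaves the tight set [S]. *)
Lemma residual_critical (E : set (I * T)) (i : I) (x : T) :
  hall_condition (residual E) ->
  ~ hall_condition (residual (E `|` [set (i, x)])) ->
  exists2 S : {fset I}, i \notin S &
    (#|` (\bigcup_(j <- S) residual E j) `|` (residual E i `\ x)| <= #|` S|)%fset%N.
Proof.
move=> hallE /existsNP[S /negP]; rewrite -ltnNge => ltS.
have subE j y : y \in residual E j -> (j, y) <> (i, x) ->
    y \in residual (E `|` [set (i, x)]) j.
  rewrite !in_residual => /andP[-> /asboolP nE] ne.
  by apply/asboolP => -[].
have iS : i \in S.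
  apply/negPn/negP => niS; move: ltS; rewrite ltnNge => /negP; apply.
  apply: leq_trans (hallE S) _; apply: fsubset_leq_card.
  apply/bigfcupsP => j jS _; apply: fsubset_trans (bigfcup_sup _ jS isT).
  apply/fsubsetP => y yj; apply: subE => // -[ji _].
  by rewrite ji (negPf niS) in jS.
exists (S `\ i)%fset; first by rewrite !inE eqxx.
rewrite -ltnS; apply: leq_trans (_ : #|` S| <= _)%N; last first.
  by rewrite (cardfsD1 i S) iS.
apply: leq_ltn_trans ltS; apply: fsubset_leq_card.
apply/fsubsetP => y; rewrite in_fsetU => /orP[/bigfcupP[j]|].
  rewrite andbT in_fsetD1 => /andP[ji jS] yj; apply/bigfcupP; exists j.
    by rewrite jS.
  by apply: subE => // -[/eqP]; rewrite (negPf ji).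
rewrite in_fsetD1 => /andP[yx yi]; apply/bigfcupP; exists i; rewrite ?iS//.
by apply: subE => // -[/eqP]; rewrite (negPf yx).
Qed.

(* Rado's proof: in a maximal set of removed edges preserving Hall's condition
   no vertex keeps two neighbours, by submodularity of S |-> #|N(S)|. *)
Theorem hall_marriage : hall_condition A ->
  exists2 f : I -> T, injective f & forall i, f i \in A i.
Proof.
move=> hallA.
have [E [hallE maxE]] := Zorn_bigcup (P := [set E | hall_condition (residual E)])
  (fun F hF totF => residual_hall_chain hallA hF totF).
have removeE i x : x \in residual E i ->
    ~ hall_condition (residual (E `|` [set (i, x)])).
  rewrite in_residual => /andP[_ /asboolP nE]; apply: maxE.
  split; first by move=> ?; left.
  by move=> /(_ (i, x)) sub; apply: nE; apply: sub; right.
have uniqE i x y : x \in residual E i -> y \in residual E i -> x = y.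
  move=> xi yi; apply/eqP/negPn/negP => xy.
  have [S iS leS] := residual_critical hallE (removeE _ _ xi).
  have [S' iS' leS'] := residual_critical hallE (removeE _ _ yi).
  have := leq_add leS leS'; rewrite leqNgt => /negP; apply.
  apply: hall_condition_sum hallE iS iS' _.
  (* As [x] and [y] differ, the two punctured neighbourhoods cover that of [i]. *)
  apply/fsubsetP => z zi; rewrite in_fsetU !in_fsetD1 zi.
  by rewrite !andbT -negb_and; apply/negP => /andP[/eqP zx /eqP zy]; rewrite -zx zy eqxx in xy.
have exE i : exists x, x \in residual E i.
  have := hallE [fset i]%fset; rewrite cardfs1 big_seq_fset1 cardfs_gt0.
  by move=> /fset0Pn.
have [f fE] := choice exE; exists f => [i j fij|i]; last first.
  by have := fE i; rewrite in_residual => /andP[].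
(* With [f i = f j] both vertices keep only this one neighbour, against Hall's condition for the
   pair. *)
apply/eqP/negPn/negP => ij; have := hallE [fset i; j]%fset.
rewrite cardfs2 ij leqNgt => /negP; apply; rewrite ltnS.
apply: leq_trans (_ : #|` [fset f i]%fset| <= _)%N; last by rewrite cardfs1.
apply: fsubset_leq_card; apply/bigfcupsP => k.
rewrite !inE => /orP[]/eqP-> _; apply/fsubsetP => x xk; rewrite inE.
  by apply/eqP; apply: uniqE xk (fE i).
by apply/eqP; rewrite fij; apply: uniqE xk (fE j).
Qed.

End Hall.

(** * Cantor-Bernstein with control of the resulting graph *)

Section CantorBernstein.
Variables (I T : Type) (f : I -> T) (g : T -> I).

(** Elements whose backward chain under [g] and [f] stops in [I], outside the range of [g]: there
    the bijection follows [f], elsewhere the inverse of [g]. *)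
Inductive ancestorless : I -> Prop :=
| Ancestorless_root i : (forall t, g t <> i) -> ancestorless i
| Ancestorless_step i : ancestorless i -> ancestorless (g (f i)).

(** The last clause confines [h] to the graph of [f] and the converse graph of [g]; it is what
    transfers displacement bounds to [h]. *)
Lemma Cantor_Bernstein_graph : injective f -> injective g ->
  exists h : I -> T, [/\ injective h, forall t, exists i, h i = t &
    forall i, h i = f i \/ g (h i) = i].
Proof.
move=> finj ginj.
have [h hP] : {h : I -> T & forall i, (ancestorless i /\ h i = f i) \/
    (~ ancestorless i /\ g (h i) = i)}.
  apply: (choice (P := fun i t => (ancestorless i /\ t = f i) \/
      (~ ancestorless i /\ g t = i))) => i.
  have [Di|nDi] := pselect (ancestorless i); first by exists (f i); left.
  have [[t gt]|ni] := pselect (exists t, g t = i); first by exists t; right.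
  by case: nDi; apply: Ancestorless_root => t gt; apply: ni; exists t.
exists h; split => [i j hij|t|i]; last 1 first.
- by have [[]|[]] := hP i; [left|right].
- have [[Di hi]|[nDi hi]] := hP i; have [[Dj hj]|[nDj hj]] := hP j.
  + by apply: finj; rewrite -hi -hj.
  + by case: nDj; rewrite -hj -hij hi; apply: Ancestorless_step.
  + by case: nDi; rewrite -hi hij hj; apply: Ancestorless_step.
  + by rewrite -hi -hj hij.
- have [Dt|nDt] := pselect (ancestorless (g t)); last first.
    by exists (g t); have [[]|[_ /ginj]] := hP (g t).
  suff [i Di fi] : exists2 i, ancestorless i & f i = t.
    by exists i; have [[_ ->]|[]] := hP i.
  (* Being in the range of [g], [g t] is no root, so the step constructor supplies the preimage of
     [t]. *)
  move: Dt; move Ei : (g t) => i Di; case: Di Ei => [j /(_ t)//|j Dj /ginj ->].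
  by exists j.
Qed.

End CantorBernstein.

(** * Counting in finite sets *)

Lemma card_set2 (T : choiceType) (a b : T) : a != b -> [set a; b] #= `I_2.
Proof.
move=> ab; apply/(fcard_eq (finite_set2 a b) (finite_II 2)).
rewrite (card_fset_set (card_eqxx `I_2)) fset_setU//.
by rewrite !fset_set1 cardfs2 ab.
Qed.

Lemma card_ge2_exists (T : choiceType) (A : set T) : finite_set A ->
  `I_2 #<= A -> exists u v, [/\ A u, A v & u != v].
Proof.
move=> finA /(leq_card_fset_set finA) le2.
have /fset0Pn[u uA] : fset_set A != fset0 by rewrite -cardfs_gt0 ltnW.
have /fset0Pn[v] : (fset_set A `\ u)%fset != fset0.
  by rewrite -cardfs_gt0; move: le2; rewrite (cardfsD1 u) uA.
rewrite !inE in_fset_set// => /andP[vu]; rewrite inE => vA.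
exists u, v; split=> //; last by rewrite eq_sym.
by move: uA; rewrite in_fset_set// inE.
Qed.

Lemma counting_finite (T : choiceType) (R : realType) (A : set T) :
  finite_set A -> counting A = (#|` fset_set A|%:R)%:E :> \bar R.
Proof. by move=> finA; rewrite /counting asboolT. Qed.

Lemma counting_ge (T : choiceType) (R : realType) (F : {fset T}) (A : set T) :
  [set` F] `<=` A -> ((#|` F|%:R)%:E <= counting A :> \bar R)%E.
Proof.
move=> FA; rewrite /counting; case: ifPn => [/asboolP finA|_]; last exact: leey.
rewrite lee_fin ler_nat; apply: fsubset_leq_card; apply/fsubsetP => x xF.
by rewrite in_fset_set// inE; exact: FA.
Qed.

Lemma card_two_images (T U : choiceType) (f : T * bool -> U) (F : {fset T}) :
  injective f ->
  #|` ([fset f (x, true) | x in F] `|` [fset f (x, false) | x in F])%fset| =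
  (2 * #|` F|)%N.
Proof.
move=> finj.
have cardI b : #|` [fset f (x, b) | x in F]%fset| = #|` F|.
  by rewrite card_imfset// => x y /finj[].
have I0 : ([fset f (x, true) | x in F] `&` [fset f (x, false) | x in F])%fset = fset0.
  apply/fsetP => u; rewrite !inE; apply/negP => /andP[].
  by move=> /imfsetP[x _ ->] /imfsetP[y _ /finj].
by rewrite -[LHS]addn0 -[X in (_ + X)%N](@cardfs0 U) -I0 cardfsUI !cardI mul2n addnn.
Qed.

(** * Displacement and neighbourhoods in a locally finite space *)

Section MetricFacts.
Context {R : realType} {X : metricType R}.
Implicit Types (S T : set X) (F : {fset X}) (K : R).

Lemma displacement_ltP S (phi : X -> X) : (displacement S phi < +oo)%E <->
  exists2 K, 0 < K & forall x, S x -> mdist (phi x) x <= K.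
Proof.
split=> [fin|[K _ le]]; last first.
  apply: le_lt_trans (ltry K); apply: ge_ereal_sup => _ [x Sx <-].
  by rewrite lee_fin; exact: le.
have [[x0 Sx0]|S0] := pselect (S !=set0); last first.
  by exists 1 => // x Sx; case: S0; exists x.
have le x : S x -> ((mdist (phi x) x)%:E <= displacement S phi)%E.
  by move=> Sx; apply: ereal_sup_ubound; exists x.
move: fin le; case: (displacement S phi) => [K _ le|//|_ /(_ _ Sx0)//].
exists (Num.max K 1) => [|x Sx]; first by rewrite lt_max ltr01 orbT.
by rewrite le_max -lee_fin le.
Qed.

Lemma bounded_mapP S T (phi : X -> X) : bounded_map S T phi <->
  set_fun S T phi /\ exists2 K, 0 < K & forall x, S x -> mdist (phi x) x <= K.
Proof. by split=> -[? /displacement_ltP]. Qed.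

Lemma neighborhood_fsetP K F x : neighborhood K [set` F] x <->
  exists2 a, a \in F & mdist x a <= K.
Proof.
split=> [|[a aF le]]; last first.
  apply: le_trans (_ : (mdist x a)%:E <= _)%E; last by rewrite lee_fin.
  by apply: ereal_inf_lbound; exists a.
rewrite /neighborhood/= => leK; apply: contrapT => far.
(* Finitely many distances above [K] have a common lower bound [e] still above [K], hence so does
   their infimum. The value [K + 1] serves the empty list, where the infimum is +oo. *)
have gap (s : seq X) : (forall a, a \in s -> K < mdist x a) ->
    exists2 e, K < e & forall a, a \in s -> e <= mdist x a.
  elim: s => [_|b s IH lts]; first by exists (K + 1); rewrite ?ltrDl.
  have [|e Ke es] := IH; first by move=> a sa; apply: lts; rewrite inE sa orbT.
  exists (Num.min e (mdist x b)) => [|a].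
    by rewrite lt_min Ke lts// inE eqxx.
  by rewrite inE ge_min => /orP[/eqP->|/es->//]; rewrite lexx orbT.
have [a aF|e Ke eF] := gap (enum_fset F).
  by rewrite ltNge; apply/negP => le; apply: far; exists a.
have : (e%:E <= K%:E)%E.
  apply: le_trans leK; apply: le_ereal_inf_tmp => _ [a aF <-].
  by rewrite lee_fin; exact: eF.
by rewrite lee_fin leNgt Ke.
Qed.

(** [fset_set] is empty on infinite sets, so this is the true neighbourhood only once local
    finiteness makes that finite. *)
Definition nbhd K F : {fset X} := fset_set (neighborhood K [set` F]).

Section LocallyFinite.
Hypothesis hX : locally_finite X.

Lemma finite_closed_ball (a : X) K : finite_set [set x | mdist x a <= K].
Proof.
apply: hX; apply: le_lt_trans (ltry (K + K)).
apply: ge_ereal_sup => _ [x xK [y yK <-]]; rewrite lee_fin.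
apply: le_trans (metric_triangle x a y) _; apply: lerD => //.
by rewrite metric_sym.
Qed.

Lemma finite_neighborhood K F : finite_set (neighborhood K [set` F]).
Proof.
apply: (@sub_finite_set _ _ (\bigcup_(a in [set` F]) [set x | mdist x a <= K])).
  by move=> x /neighborhood_fsetP[a aF le]; exists a.
by apply: bigcup_finite => // a _; exact: finite_closed_ball.
Qed.

Lemma in_nbhd K F x :
  reflect (exists2 a, a \in F & mdist x a <= K) (x \in nbhd K F).
Proof.
rewrite in_fset_set ?inE; last exact: finite_neighborhood.
apply: (iffP idP) => [/asboolP/neighborhood_fsetP//|h].
by apply/asboolP/neighborhood_fsetP.
Qed.

Lemma doublingP : doubling X <->
  exists2 K, 0 < K & forall F, (2 * #|` F| <= #|` nbhd K F|)%N.
Proof.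
have natE F K : (2%:E * counting [set` F] <= counting (neighborhood K [set` F])
    :> \bar R)%E <-> (2 * #|` F| <= #|` nbhd K F|)%N.
  rewrite !counting_finite//; last exact: finite_neighborhood.
  by rewrite set_fsetK -EFinM lee_fin -natrM ler_nat.
split=> -[K K0 le]; exists K => // F.
  have [->|/fset0Pn[x xF]] := eqVneq F fset0; first by rewrite cardfs0.
  by apply/natE/le => //; exists x.
by move=> /finite_fsetP[G ->] _; apply/natE.
Qed.

Lemma nbhd_sub K F : 0 <= K -> (F `<=` nbhd K F)%fset.
Proof.
by move=> K0; apply/fsubsetP => x xF; apply/in_nbhd; exists x; rewrite ?mdistxx.
Qed.

Lemma nbhd_nbhd K L F : (nbhd K (nbhd L F) `<=` nbhd (K + L) F)%fset.
Proof.
apply/fsubsetP => x /in_nbhd[y /in_nbhd[a aF ya] xy]; apply/in_nbhd; exists a => //.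
by apply: le_trans (metric_triangle x y a) _; apply: lerD.
Qed.

(** Each further enlargement by [K] adds at least [eps * #|F|] points, because the set reached so
    far contains [F]; this linear growth in [n] is enough to reach the factor 2. *)
Lemma expansion_doubling K (eps : R) : 0 <= K -> 0 < eps ->
  (forall F, (1 + eps) * #|` F|%:R <= #|` nbhd K F|%:R) -> doubling X.
Proof.
move=> K0 eps0 expK.
have growth F n : (1 + n%:R * eps) * #|` F|%:R <= #|` nbhd (n%:R * K) F|%:R.
  elim: n => [|n IH].
    by rewrite !mul0r addr0 mul1r ler_nat fsubset_leq_card// nbhd_sub.
  have cardS : #|` F|%:R <= #|` nbhd (n%:R * K) F|%:R :> R.
    by rewrite ler_nat fsubset_leq_card// nbhd_sub// mulr_ge0.
  have sub : #|` nbhd K (nbhd (n%:R * K) F)|%:R <= #|` nbhd (n.+1%:R * K) F|%:R :> R.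
    rewrite ler_nat fsubset_leq_card// mulrSr mulrDl mul1r addrC.
    exact: nbhd_nbhd.
  apply: le_trans sub; apply: le_trans (expK _).
  have := ler_wpM2l (ltW eps0) cardS; rewrite -natr1; lra.
pose n := (Num.truncn eps^-1).+1.
have n_eps : 1 <= n%:R * eps.
  by rewrite -ler_pdivrMr// div1r ltW// truncnS_gt.
(* Adding 1 makes the radius positive even when [K] is 0. *)
apply/doublingP; exists (n%:R * K + 1) => [|F].
  by rewrite ltr_wpDl// mulr_ge0.
rewrite -(@ler_nat R) natrM.
apply: le_trans (_ : (1 + n%:R * eps) * #|` F|%:R <= _).
  by rewrite ler_wpM2r// -[2]/(1 + 1) lerD2l.
apply: le_trans (growth F n) _; rewrite ler_nat fsubset_leq_card//.
apply/fsubsetP => x /in_nbhd[a aF le]; apply/in_nbhd; exists a => //.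
by rewrite (le_trans le)// lerDl.
Qed.

End LocallyFinite.
End MetricFacts.

Lemma card_eq1_unique (T : choiceType) (A : set T) (x y : T) :
  A #= `I_1 -> A x -> A y -> x = y.
Proof.
move=> A1 Ax Ay; have finA : finite_set A by apply/finite_setP; exists 1%N.
have /eqP/cardfs1P[z Az] := card_fset_set A1.
have mem u : A u -> u = z.
  by move=> Au; apply/eqP; rewrite -in_fset1 -Az in_fset_set// inE.
by rewrite (mem x)// (mem y).
Qed.

(** * Pseudogroup elements and their displacement *)

Section Equivalence.
Context {R : realType} {X : metricType R}.

Definition bounded_two_copies (f : X * bool -> X) : Prop :=
  exists2 K : R, 0 < K & forall p, mdist (f p) p.1 <= K.

(** [f] is overwritten by the identity outside [S], as [pfun_out] demands. *)
Lemma pseudogroup_of_bij (S T : set X) (f : X -> X) : set_bij S T f ->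
  (exists2 K : R, 0 < K & forall x, S x -> mdist (f x) x <= K) ->
  exists g : pseudogroup X,
    [/\ alpha g = S, omega g = T & forall x, S x -> g x = f x].
Proof.
move=> [fS finj fsurj] fK; pose g x := if `[< S x >] then f x else x.
have gE x : S x -> g x = f x by rewrite /g => Sx; rewrite asboolT.
have gfun : set_fun S T g by move=> x Sx; rewrite gE//; exact: fS.
have gbnd : bounded_map S T g.
  apply/bounded_mapP; split=> //; case: fK => K K0 le; exists K => // x Sx.
  by rewrite gE//; exact: le.
have gbij : set_bij S T g.
  split=> // [x y xS yS|y /fsurj[x Sx <-]].
    have [Sx Sy] : S x /\ S y by rewrite !inE in xS yS.
    by rewrite !gE//; exact: finj.
  by exists x => //; rewrite gE.
have gout x : ~ S x -> g x = x by move=> nS; rewrite /g asboolF.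
by exists (Pseudogroup gbnd gbij gout).
Qed.

Lemma pseudogroup_bounded (g : pseudogroup X) :
  exists2 K : R, 0 < K & forall x, alpha g x -> mdist (g x) x <= K.
Proof. by have /bounded_mapP[] := pfun_bounded g. Qed.

(** One bound is chosen per element, and the finitely many bounds on [Q] have a maximum; starting it
    at 1 keeps it positive, also for empty [Q]. *)
Lemma finite_pseudogroup_bounded (Q : set (pseudogroup X)) : finite_set Q ->
  exists2 K : R, 0 < K &
    forall g x, Q g -> alpha g x -> mdist (g x) x <= K.
Proof.
move=> finQ.
have [k kP] := choice (fun g => (let: ex_intro2 K _ le := pseudogroup_bounded g in
  ex_intro (fun K : R => forall x, alpha g x -> mdist (g x) x <= K) K le)).
have /finite_seqP[s sE] : finite_set (k @` Q) by exact: finite_image.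
exists (\big[Num.max/1]_(r <- s) r).
  by apply: lt_le_trans ltr01 _; exact: bigmax_ge_id.
move=> g x Qg gx; apply: le_trans (kP g x gx) _.
have ks : k g \in s.
  by have : (k @` Q) (k g) by [exists g]; rewrite sE.
exact: (@le_bigmax_seq _ _ _ s 1 (k g) xpredT (fun r : R => r) ks isT).
Qed.

(** * Doubling and the Følner condition *)

Hypothesis hX : locally_finite X.

(** Both copies of [F] land in its [K]-neighbourhood, and injectivity keeps their images apart. *)
Lemma injection_doubling (f : X * bool -> X) :
  injective f -> bounded_two_copies f -> doubling X.
Proof.
move=> finj [K K0 fK]; apply/doublingP => //; exists K => // F.
rewrite -(card_two_images F finj) fsubset_leq_card//.
apply/fsubsetP => y; rewrite in_fsetU => /orP[]/imfsetP[x xF ->];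
  by apply/in_nbhd => //; exists x => //; exact: (fK (x, _)).
Qed.

Lemma doubling_bijection : doubling X -> exists h : X * bool -> X,
  [/\ injective h, forall y, exists p, h p = y & bounded_two_copies h].
Proof.
move=> /(doublingP hX)[K K0 le2].
pose A (p : X * bool) := nbhd K [fset p.1]%fset.
have hallA : hall_condition A.
  move=> S; pose F := [fset p.1 | p in S]%fset.
  (* [S] sits inside the two copies of its projection [F], and the [K]-neighbourhood of [F] is
     covered by the sets [A p] with [p] in [S]. *)
  apply: leq_trans (_ : 2 * #|` F| <= _)%N.
    rewrite -(card_two_images F (f := id))// fsubset_leq_card//.
    apply/fsubsetP => -[x b] xbS; have xF : x \in F.
      by apply/imfsetP; exists (x, b).
    by rewrite in_fsetU; case: b xbS => _; apply/orP; [left|right];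
      apply/imfsetP; exists x.
  apply: leq_trans (le2 F) _; apply: fsubset_leq_card; apply/fsubsetP => y.
  move=> /(in_nbhd hX)[_ /imfsetP[p /= pS ->] le]; apply/bigfcupP.
  exists p; first by rewrite pS.
  by apply/in_nbhd => //; exists p.1; rewrite ?inE.
have [f finj fA] := hall_marriage hallA.
have [//||h [hinj hsurj hE]] := @Cantor_Bernstein_graph _ _ f (fun x => (x, true)).
  by move=> x y [].
exists h; split=> //; exists K => // p.
(* Where [h] follows the inverse of [x |-> (x, true)], it is the first projection and moves
   nothing. *)
have [->|/(congr1 fst)/= <-] := hE p; last by rewrite mdistxx ltW.
by have /(in_nbhd hX)[a] := fA p; rewrite inE => /eqP->.
Qed.

(** The test family consists of the two maps [f (_, b)], with [eps = 1]. The images of [G] under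
    them have [2 * #|G|] points, at most [#|G|] of them in [G]; the others are carried into [G] by
    an inverse map, so they form a part of the boundary at least as large as [G]. *)
Lemma injection_not_Folner (f : X * bool -> X) :
  injective f -> bounded_two_copies f -> ~ Folner X.
Proof.
move=> finj [K K0 fK] folner.
have gP b : exists g : pseudogroup X, [/\ alpha g = setT,
    omega g = range (fun x => f (x, b)) & forall x, g x = f (x, b)].
  have [||g [ga go gE]] := @pseudogroup_of_bij setT (range (fun x => f (x, b)))
      (fun x => f (x, b)).
  - split=> [x _|x y _ _ /finj[]//|//]; by exists x.
  - by exists K => // x _; exact: (fK (x, b)).
  - by exists g; split=> // x; apply: gE.
have [g {}gP] := choice gP.
have [F [/finite_fsetP[G ->] _]] := folner _ (finite_set2 (g true) (g false)) _ ltr01.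
rewrite mul1e [X in (_ < X)%E]counting_finite// set_fsetK ltNge => /negP; apply.
set D := ([fset f (x, true) | x in G] `|` [fset f (x, false) | x in G])%fset.
apply: le_trans (_ : (#|` (D `\` G)%fset|%:R%:E <= _)%E).
  rewrite lee_fin ler_nat -(leq_add2l #|` (D `&` G)%fset|) cardfsID.
  rewrite (card_two_images G finj) mul2n -addnn leq_add2r.
  by rewrite fsubset_leq_card// fsubsetIr.
apply: counting_ge => y; rewrite /= in_fsetD => /andP[yG yD].
split; first exact/negP.
have [b [x xG yE]] : exists b, exists2 x, x \in G & y = f (x, b).
  by move: yD; rewrite in_fsetU => /orP[]/imfsetP[x /= xG ->];
    [exists true|exists false]; exists x.
have [ga go gE] := gP b.
exists (pinverse (g b)).
  by right; exists (g b) => //; case: b {xG yE ga go gE}; [left|right].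
split; first by rewrite /= go yE; exists x.
by rewrite /= yE -gE Defs.inv_funK// ga inE.
Qed.

(** With [K] bounding the displacement of [Q] and of its inverses, the boundary of [F] lies in the
    [K]-neighbourhood minus [F]. Failure of the Følner condition thus gives expansion by the factor
    [1 + eps]. *)
Lemma not_Folner_doubling : ~ Folner X -> doubling X.
Proof.
move=> /existsNP[Q /not_implyP[finQ /existsNP[eps /not_implyP[eps0 noF]]]].
have finQ' : finite_set (Q `|` @pinverse R X @` Q).
  by rewrite finite_setU; split=> //; exact: finite_image.
have [K K0 QK] := finite_pseudogroup_bounded finQ'.
apply: (@expansion_doubling _ _ hX K eps) => // [|F]; first exact: ltW.
have [->|/fset0Pn[x0 x0F]] := eqVneq F fset0; first by rewrite cardfs0 mulr0.
have sub : boundary Q [set` F] `<=` [set` (nbhd K F `\` F)%fset].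
  move=> x [nFx [rho Qrho [ax rhoF]]] /=; rewrite in_fsetD; apply/andP; split.
    exact/negP.
  apply/in_nbhd => //; exists (rho x) => //.
  by rewrite metric_sym; exact: QK.
have finB : finite_set (boundary Q [set` F]) by exact: sub_finite_set sub _.
have : eps * #|` F|%:R <= #|` (nbhd K F `\` F)%fset|%:R.
  apply: (@le_trans _ _ #|` fset_set (boundary Q [set` F])|%:R); last first.
    by rewrite ler_nat fsubset_leq_card// -[X in (_ `<=` X)%fset]set_fsetK -fset_set_sub.
  rewrite leNgt; apply/negP => lt; apply: noF; exists [set` F]; split=> //.
    by exists x0.
  by rewrite !counting_finite// set_fsetK -EFinM lte_fin.
move=> le; rewrite mulrDl mul1r.
rewrite -(cardfsID F (nbhd K F)) natrD lerD// ler_nat fsubset_leq_card//.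
by rewrite fsubsetI fsubset_refl nbhd_sub// ltW.
Qed.

(** * Paradoxical decompositions, matchings and two-to-one maps *)

(** The pieces are the images under [h] of the two copies of the space, and each is mapped onto the
    whole space by [h (x, b) |-> x]. *)
Lemma bijection_paradoxical (h : X * bool -> X) :
  injective h -> (forall y, exists p, h p = y) -> bounded_two_copies h ->
  paradoxical X.
Proof.
move=> hinj hsurj [K K0 hK]; have [k kK] := choice hsurj.
have kh p : k (h p) = p by apply: hinj; rewrite kK.
have gP b : exists g : pseudogroup X,
    alpha g = range (fun x => h (x, b)) /\ omega g = setT.
  have [||g [ga go _]] := @pseudogroup_of_bij (range (fun x => h (x, b))) setT
      (fun y => (k y).1); last by exists g.
  - split=> // [y z|x _]; last by exists (h (x, b)); [exists x|rewrite kh].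
    by rewrite !inE => -[x _ <-] [x' _ <-]; rewrite !kh /= => ->.
  - exists K => // _ [x _ <-]; rewrite kh metric_sym; exact: (hK (x, b)).
have [[g1 [a1 o1]] [g2 [a2 o2]]] := (gP true, gP false).
exists (alpha g1), (alpha g2), g1, g2; split=> //.
  by rewrite a1 a2 -subset0 => _ [[x _ <-] [y _ /hinj]].
apply/seteqP; split=> // y _; rewrite a1 a2; have [[x b] <-] := hsurj y.
by case: b; [left|right]; exists x.
Qed.

(** Each [x] on the left is joined to [h (x, true)] and [h (x, false)]; bijectivity of [h] gives
    exactly one edge at each right vertex. *)
Lemma bijection_perfect_matching (h : X * bool -> X) :
  injective h -> (forall y, exists p, h p = y) -> bounded_two_copies h ->
  exists2 K : R, 0 < K & exists M : set (X * X),
    perfect_matching 2 1 (dist_graph K [set: X] [set: X]) M.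
Proof.
move=> hinj hsurj [K K0 hK]; exists K => //.
exists [set e | exists b, e.2 = h (e.1, b)]; split=> [[x y]|x _|y _] /=.
- by move=> [b /= ->]; split=> //=; rewrite metric_sym; exact: (hK (x, b)).
- rewrite (_ : [set e | _] = [set (x, h (x, true)); (x, h (x, false))]).
    by apply: card_set2; apply/eqP => -[/hinj].
  apply/seteqP; split=> [[x' y] /= [[b ->] ->]|_ [|] -> /=].
  + by case: b; [left|right].
  + by split=> //; exists true.
  + by split=> //; exists false.
- have [[x b] hx] := hsurj y; rewrite (_ : [set e | _] = [set (x, y)]).
    exact: card_set1.
  apply/seteqP; split=> [[x' y'] /= [[b' ->]]|_ -> /=].
    by rewrite -hx => /hinj[-> ->].
  by split=> //; exists b; rewrite hx.
Qed.

(** The booleans number the two edges at each left vertex, and [f] reads off their right ends. *)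
Lemma perfect_matching_injection (K : R) (M : set (X * X)) : 0 < K ->
  perfect_matching 2 1 (dist_graph K [set: X] [set: X]) M ->
  exists2 f : X * bool -> X, injective f & bounded_two_copies f.
Proof.
move=> K0 [ME ML MR].
have uvP x : exists p : X * X, [/\ M (x, p.1), M (x, p.2) & p.1 != p.2].
  have Mx := ML x I; have finM : finite_set [set e | M e /\ e.1 = x].
    by apply/finite_setP; exists 2%N.
  have [[x1 u] [[x2 v] [[/= Mu ux] [/= Mv vx] uv]]] := card_ge2_exists finM
    ((card_eqPle _ _).1 Mx).2.
  exists (u, v); rewrite ux in Mu uv; rewrite vx in Mv uv; split=> //=.
  by apply: contraNneq uv => ->.
have [p pP] := choice uvP.
pose f (q : X * bool) := if q.2 then (p q.1).1 else (p q.1).2.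
have Mf q : M (q.1, f q) by rewrite /f; have [] := pP q.1; case: ifP.
exists f => [q q' ff|]; last first.
  exists K => // q; have [_ _] := ME _ (Mf q); by rewrite metric_sym.
(* A right vertex has only one edge, so equal values come from the same left vertex. *)
have /(congr1 fst)/= qq : (q.1, f q) = (q'.1, f q').
  by apply: (card_eq1_unique (MR (f q) I)); split=> //=.
case: q q' qq ff {ME} => [x b] [x' b'] /= <-; rewrite /f /=.
have [_ _ ne] := pP x; case: b b' => -[] //= e.
  by rewrite e eqxx in ne.
by rewrite e eqxx in ne.
Qed.

(** Gluing [g1] and [g2] along the partition gives every point exactly one preimage in each
    piece. *)
Lemma paradoxical_two_to_one : paradoxical X ->
  exists2 phi : X -> X, bounded_map setT setT phi &
    forall x : X, phi @^-1` [set x] #= `I_2.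
Proof.
move=> [X1 [X2 [g1 [g2 [X12 XU [a1 o1] [a2 o2]]]]]].
pose phi x := if `[< X1 x >] then g1 x else g2 x.
have phi1 x : X1 x -> phi x = g1 x by move=> h; rewrite /phi asboolT.
have X2E x : X2 x <-> ~ X1 x.
  split=> [h2 h1|h1]; first by have : (X1 `&` X2) x by []; rewrite X12.
  by have [|//] : (X1 `|` X2) x by rewrite XU.
have phi2 x : X2 x -> phi x = g2 x by move=> /X2E h; rewrite /phi asboolF.
exists phi => [|x].
  apply/bounded_mapP; split=> //.
  have [K1 K10 le1] := pseudogroup_bounded g1.
  have [K2 _ le2] := pseudogroup_bounded g2.
  exists (Num.max K1 K2) => [|x _]; first by rewrite lt_max K10.
  have [h1|/X2E h2] := pselect (X1 x).
    by rewrite phi1// le_max le1// a1.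
  by rewrite phi2// le_max le2 ?orbT// a2.
have [_ inj1 surj1] := pfun_bij g1; have [_ inj2 surj2] := pfun_bij g2.
rewrite a1 o1 in inj1 surj1; rewrite a2 o2 in inj2 surj2.
have [u u1 ux] := surj1 x I; have [v v2 vx] := surj2 x I.
rewrite (_ : _ @^-1` _ = [set u; v]).
  by apply: card_set2; apply/eqP => uv; move/X2E: v2; rewrite -uv.
apply/seteqP; split=> [y /= yx|y [->|->] /=]; last 2 first.
- by rewrite phi1.
- by rewrite phi2.
have [h1|/X2E h2] := pselect (X1 y); [left|right].
  by apply: inj1; rewrite ?inE// -phi1// yx.
by apply: inj2; rewrite ?inE// -phi2// yx.
Qed.

(** [f] selects two distinct preimages in each fibre, so [phi] recovers the first coordinate and its
    displacement bound passes to [f]. *)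
Lemma Gromov_injection (phi : X -> X) : bounded_map setT setT phi ->
  (forall x : X, `I_2 #<= phi @^-1` [set x]) ->
  exists2 f : X * bool -> X, injective f & bounded_two_copies f.
Proof.
move=> /bounded_mapP[_ [K K0 phiK]] phi2.
have uvP x : exists p : X * X, [/\ phi p.1 = x, phi p.2 = x & p.1 != p.2].
  (* Points of the fibre are moved to [x] by at most [K], so they lie in a closed ball. *)
  have fin : finite_set (phi @^-1` [set x]).
    apply: sub_finite_set (finite_closed_ball hX x K) => y /= <-.
    by rewrite metric_sym; exact: phiK.
  by have [u [v [pu pv uv]]] := card_ge2_exists fin (phi2 x); exists (u, v).
have [p pP] := choice uvP.
pose f (q : X * bool) := if q.2 then (p q.1).1 else (p q.1).2.
have phif q : phi (f q) = q.1 by rewrite /f; have [] := pP q.1; case: ifP.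
exists f => [q q' ff|].
  have qq : q.1 = q'.1 by rewrite -!phif ff.
  case: q q' qq ff => [x b] [x' b'] /= <-; rewrite /f /=.
  by have [_ _ /eqP ne] := pP x; case: b b' => -[] //= e; case: ne.
exists K => // q; rewrite -(phif q) metric_sym; exact: phiK.
Qed.

End Equivalence.

(** * The cycle of implications *)

Theorem theorem32 (R : realType) (X : metricType R) (hX : locally_finite X) :
  [<-> paradoxical X;
       exists2 phi : X -> X, bounded_map setT setT phi &
         forall x : X, phi @^-1` [set x] #= `I_2;
       exists2 phi : X -> X, bounded_map setT setT phi &
         forall x : X, `I_2 #<= phi @^-1` [set x];
       doubling X;
       exists2 K : R, 0 < K &
         exists M : set (X * X),
           perfect_matching 2 1 (dist_graph K [set: X] [set: X]) M;
       ~ Folner X].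
Proof.
tfae.
- exact: paradoxical_two_to_one.
- by move=> [phi phiB phi2]; exists phi => // x; have /card_eqPle[] := phi2 x.
- move=> [phi phiB phi2].
  have [f] := Gromov_injection hX phiB phi2; exact: injection_doubling.
- move=> /(doubling_bijection hX)[h [hinj hsurj hK]].
  exact: bijection_perfect_matching hinj hsurj hK.
- move=> [K K0 [M MP]].
  have [f] := perfect_matching_injection K0 MP; exact: injection_not_Folner.
- move=> /(not_Folner_doubling hX)/(doubling_bijection hX)[h [hinj hsurj hK]].
  exact: bijection_paradoxical hinj hsurj hK.
Qed.
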